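(* Let $X$ be a topological space and $\kappa$ a cardinal. Then: (1) Player one has a winning strategy in $G^p_o(\kappa)$ on $X$ if and only if player two has a winning strategy in $G^\kappa_1(\mathcal{O},\mathcal{O}_D)$ on $X$. (2) Player two has a winning strategy in $G^p_o(\kappa)$ on $X$ if and only if player one has a winning strategy in $G^\kappa_1(\mathcal{O},\mathcal{O}_D)$ on $X$.
   Context: Both games are two-player perfect-information games with $\kappa$ many innings. In $G^p_o(\kappa)$ (the open-picking game), at inning $\alpha<\kappa$ player one picks a point $x_\alpha\in X$ and then player two picks an open set $U_\alpha$ with $x_\alpha\in U_\alpha$; player one wins if and only if $\bigcup_{\alpha<\kappa}U_\alpha$ is dense in $X$ (otherwise player two wins). In $G^\kappa_1(\mathcal{O},\mathcal{O}_D)$, at inning $\alpha<\kappa$ player one picks an open cover $\mathcal{U}_\alpha$ of $X$ and then player two picks an open set $U_\alpha\in\mathcal{U}_\alpha$; player two wins if $\bigcup_{\alpha<\kappa}U_\alpha$ is dense in $X$, and otherwise player one wins. *)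

(* Defs.v *)
From HB Require Import structures.
From mathcomp Require Import all_boot all_order.
From mathcomp Require Import boolp classical_sets functions cardinality wochoice.
From mathcomp Require Import topology.

Set Implicit Arguments.
Unset Strict Implicit.
Unset Printing Implicit Defensive.

Local Open Scope order_scope.
Local Open Scope classical_set_scope.
Local Open Scope card_scope.

(* Cardinals are initial ordinals: K, ordered as the set of all ordinals below
   the cardinal, is well ordered and does not inject into any of its proper
   initial segments. Finite cardinals, including 0, are allowed. *)
Definition is_cardinal d (K : orderType d) : Prop :=
  well_order (<=%O : rel K) /\
  forall a : K, ~ ([set: K] #<= [set b : K | b < a]).

Section Games.
Context d (K : orderType d).

(* In each inning player one makes a move x, then player two answers with a move
   y such that [legal x y]. Player two wins a play exactly when player one does
   not. *)
Record game := Game {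
  move1 : Type;
  move2 : Type;
  legal : move1 -> move2 -> Prop;
  one_wins : (K -> move1) -> (K -> move2) -> Prop }.

Record inning (G : game) := Inning {
  fst_move : move1 G;
  snd_move : move2 G;
  _ : legal fst_move snd_move }.

Definition play (G : game) := K -> inning G.

Definition history (G : game) (a : K) := forall b : K, b < a -> inning G.

Definition past (G : game) (p : play G) (a : K) : history G a :=
  fun b _ => p b.
Arguments past {G} p a b _.

(* Strategies prescribe a legal move after every history. A player who may be
   left without a legal move has no strategy at all (this matters only for the
   empty space). *)
Definition strategy1 (G : game) := forall a : K, history G a -> move1 G.

Definition strategy2 (G : game) :=
  forall a : K, history G a -> forall x : move1 G, {y : move2 G | legal x y}.

Definition winning1 (G : game) (s : strategy1 G) : Prop :=
  forall p : play G,
    (forall a, fst_move (p a) = s a (past p a)) ->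
    one_wins (fun a => fst_move (p a)) (fun a => snd_move (p a)).

Definition winning2 (G : game) (s : strategy2 G) : Prop :=
  forall p : play G,
    (forall a, snd_move (p a) = sval (s a (past p a) (fst_move (p a)))) ->
    ~ one_wins (fun a => fst_move (p a)) (fun a => snd_move (p a)).

Definition one_has_winning_strategy (G : game) : Prop :=
  exists s : strategy1 G, winning1 s.

Definition two_has_winning_strategy (G : game) : Prop :=
  exists s : strategy2 G, winning2 s.

Context (X : topologicalType).

Definition is_open_cover (C : set (set X)) : Prop :=
  (forall U, C U -> open U) /\ \bigcup_(U in C) U = [set: X].

Definition open_picking_game : game :=
  @Game X (set X) (fun x U => open U /\ U x)
    (fun _ U => dense (\bigcup_a U a)).

Definition selection_game : game :=
  @Game {C : set (set X) | is_open_cover C} (set X) (fun C U => sval C U)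
    (fun _ U => ~ dense (\bigcup_a U a)).

End Games.

(* Main.v *)
(* Each player's winning strategy is turned into one for the opponent's role in
   the other game by translating histories inning by inning. A point x meets a
   cover in some member containing x, and a strategy answering points by
   neighbourhoods yields the cover of all its answers. The remaining direction,
   from player two's answers to covers back to points, rests on this: some point
   x is such that every open neighbourhood of x is the answer to some cover, as
   otherwise the never-answered neighbourhoods, one for each point, would form a
   cover without an answer. *)
Require Import Defs.
From mathcomp Require Import all_boot all_order.
From mathcomp Require Import boolp classical_sets wochoice.
From mathcomp Require Import topology.

Set Implicit Arguments.
Unset Strict Implicit.
Unset Printing Implicit Defensive.

Import Order.TTheory.
Local Open Scope order_scope.
Local Open Scope classical_set_scope.

Local Arguments past {d K G} p a b _.

Lemma well_order_wf d (K : orderType d) :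
  well_order (<=%O : rel K) -> well_founded (fun a b : K => a < b).
Proof.
move=> wo a; apply: contrapT => nacc.
have [|m [[/asboolP nm lem] _]] := wo [pred b | `[< ~ Acc (fun a b : K => a < b) b >]].
  by exists a; apply/asboolP.
apply: nm; constructor => b ltbm; apply: contrapT => nb.
have := lem b; rewrite inE => /(_ nb).
by rewrite leNgt ltbm.
Qed.

Lemma inning_legal d (K : orderType d) (G : game K) (i : inning G) :
  legal (fst_move i) (snd_move i).
Proof. by case: i. Qed.

(** [F a i h] translates the inning [i] played at [a], given the history [h] translated so far.
    Well-founded recursion yields [T]; since the translation at [b] depends only on the innings up
    to [b], the translated pasts of one play [p] fit together into a single play [q]. *)
Lemma history_translation d (K : orderType d) (G G' : game K)
    (F : forall a : K, inning G -> history G' a -> inning G') :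
  well_founded (fun a b : K => a < b) ->
  exists T : forall a : K, history G a -> history G' a,
  forall p : play G, exists q : play G',
  forall a, q a = F a (p a) (past q a) /\ T a (past p a) = past q a.
Proof.
move=> wf.
(* The recursion runs on [b] inside a fixed [h]; the bound by [a] stays in the result type because
   [h] is defined only below [a]. *)
pose step a (h : history G a) b (rec : forall c, c < b -> c < a -> inning G')
    (ltba : b < a) : inning G' :=
  F b (h b ltba) (fun c ltcb => rec c ltcb (lt_trans ltcb ltba)).
pose T a (h : history G a) : history G' a := Fix wf _ (step a h).
have TE a h b (ltba : b < a) : T a h b ltba =
    F b (h b ltba) (fun c ltcb => T a h c (lt_trans ltcb ltba)).
  rewrite /T Fix_eq // => c f g fg; congr (step _ _ _ _).
  by do 2![apply: functional_extensionality_dep => ?]; apply: fg.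
exists T => p.
(* Coherence: pasts of [p] of different lengths give the same translated inning at [b]. *)
have Tcoh b : forall a a' (ltba : b < a) (ltba' : b < a'),
    T a (past p a) b ltba = T a' (past p a') b ltba'.
  elim/(well_founded_ind wf): b => b IH a a' ltba ltba'.
  rewrite !TE; congr (F _ _ _).
  by apply: functional_extensionality_dep => c;
    apply: functional_extensionality_dep => ltcb; apply: IH.
pose q a := F a (p a) (T a (past p a)).
have Tq a : T a (past p a) = past q a.
  apply: functional_extensionality_dep => b.
  apply: functional_extensionality_dep => ltba.
  rewrite TE /past /q; congr (F _ _ _).
  by apply: functional_extensionality_dep => c;
    apply: functional_extensionality_dep => ltcb; apply: Tcoh.
by exists q => a; split; rewrite // -Tq.
Qed.

Lemma cover_member (X : topologicalType) (C : {C : set (set X) | is_open_cover C})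
  (x : X) : exists U, sval C U /\ U x.
Proof.
case: C => C [/= _ covC]; have : [set: X] x by [].
by rewrite -covC => -[U CU Ux]; exists U.
Qed.

Lemma cover_open (X : topologicalType) (C : {C : set (set X) | is_open_cover C})
  (U : set X) : sval C U -> open U.
Proof. by case: C => C [/= openC _]; apply: openC. Qed.

Lemma setT_cover (X : topologicalType) : is_open_cover [set [set: X]].
Proof.
by split=> [U ->|]; [exact: openT | rewrite bigcup_set1].
Qed.

Lemma range_cover (X : topologicalType) (V : X -> set X) :
  (forall x, open (V x) /\ V x x) -> is_open_cover (range V).
Proof.
move=> VP; split=> [_ [x _ <-]|]; first by case: (VP x).
rewrite -subTset => x _; exists (V x); first by exists x.
by case: (VP x).
Qed.

Lemma exists_point_all_answers (X : topologicalType)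
    (f : forall C : {C : set (set X) | is_open_cover C}, {U | sval C U}) :
  exists x, forall U, open U -> U x -> exists C, sval (f C) = U.
Proof.
apply: contrapT => nx.
have {nx} badx x : {U : set X | (open U /\ U x) /\ forall C, sval (f C) <> U}.
  apply: cid; apply: contrapT => nU; apply: nx; exists x => U oU Ux.
  by apply: contrapT => nC; apply: nU; exists U; split=> // C fCU; apply: nC; exists C.
have cov := range_cover (fun x => (svalP (badx x)).1).
(* The answer to the cover of never-answered neighbourhoods is one of them. *)
case fC: (f (exist _ _ cov)) => [U [x xT eU]].
by apply: (svalP (badx x)).2 (exist _ _ cov) _; rewrite fC.
Qed.

Section Translations.
Context d (K : orderType d) (X : topologicalType).
Context (wf : well_founded (fun a b : K => a < b)).

Local Notation P := (open_picking_game K X).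
Local Notation S := (selection_game K X).

Lemma picking_one_selection_two :
  one_has_winning_strategy P -> two_has_winning_strategy S.
Proof.
case=> s win.
(* Translation must be total: if the set played misses the point prescribed by [s], the whole space
   serves as a dummy reply. Plays following the new strategy never reach this case. *)
have move a (i : inning S) (h : history P a) :
    {j : inning P | fst_move j = s a h /\
      (snd_move i (s a h) -> snd_move j = snd_move i)}.
  apply: cid; case: (pselect (snd_move i (s a h))) => Ux.
    have legUx : @legal _ _ P (s a h) (snd_move i).
      by split=> //; apply: cover_open (inning_legal i).
    by exists (Inning legUx).
  have legT : @legal _ _ P (s a h) setT by split=> //; exact: openT.
  by exists (Inning legT).
have [T TP] := history_translation (fun a i h => sval (move a i h)) wf.
have answer a (h : history S a) (C : move1 S) :
    {U : move2 S | legal C U /\ U (s a (T a h))}.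
  exact: cid (cover_member C _).
exists (fun a h C => exist _ _ (svalP (answer a h C)).1) => p ps.
have [q qP] := TP p.
have qs a : fst_move (q a) = s a (past q a).
  by case: (qP a) => -> _; case: (svalP (move a (p a) (past q a))).
(* Only player two's sets decide who wins, so their agreement in [p] and [q] transfers the
   outcome. *)
have qp a : snd_move (q a) = snd_move (p a).
  case: (qP a) => qaE Tq; rewrite qaE.
  case: (svalP (move a (p a) (past q a))) => _; apply.
  by rewrite ps /= -Tq; case: (svalP (answer a (past p a) (fst_move (p a)))).
have := win q qs; rewrite /= (funext qp).
by move=> ?; apply.
Qed.

Lemma selection_two_picking_one :
  two_has_winning_strategy S -> one_has_winning_strategy P.
Proof.
case=> s win.
pose point a (h : history S a) := cid (exists_point_all_answers (s a h)).
have move a (i : inning P) (h : history S a) :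
    {j : inning S | snd_move j = sval (s a h (fst_move j)) /\
      (fst_move i = sval (point a h) -> snd_move j = snd_move i)}.
  apply: cid; case: (pselect (fst_move i = sval (point a h))) => ix.
    have [oU Ux] := inning_legal i.
    (* The translated move is a cover [C] to which [s] answers exactly player two's set; the
       one-member cover below is only a dummy. *)
    rewrite ix in Ux; have [C sC] := svalP (point a h) _ oU Ux.
    by exists (Inning (svalP (s a h C))); split=> // _; rewrite /= sC.
  by exists (Inning (svalP (s a h (exist _ _ (setT_cover X))))).
have [T TP] := history_translation (fun a i h => sval (move a i h)) wf.
exists (fun a h => sval (point a (T a h))) => p ps.
have [q qP] := TP p.
have qs a : snd_move (q a) = sval (s a (past q a) (fst_move (q a))).
  by case: (qP a) => -> _; case: (svalP (move a (p a) (past q a))).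
have qp a : snd_move (q a) = snd_move (p a).
  case: (qP a) => qaE Tq; rewrite qaE.
  by case: (svalP (move a (p a) (past q a))) => _; apply; rewrite ps Tq.
have := win q qs; rewrite /= (funext qp).
(* Defeating player one in [S] means that the union is not non-dense. *)
exact: contrapT.
Qed.

Lemma picking_two_selection_one :
  two_has_winning_strategy P -> one_has_winning_strategy S.
Proof.
case=> s win.
pose answers a (h : history P a) : move1 S :=
  exist _ _ (range_cover (fun x => svalP (s a h x))).
(* When X is empty, innings of S need not translate to innings of P. *)
have [[x0]|X0] := pselect (inhabited X); last first.
  have cov0 : is_open_cover (set0 : set (set X)).
    by split=> [//|]; rewrite -subTset => x; case: X0.
  exists (fun _ _ => exist _ _ cov0) => p ps.
  (* Player two cannot answer the empty cover, so a play exists only if there are no innings. The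
     empty play of [P] then contradicts [win], since every set is dense in the empty space. *)
  have K0 (a : K) : False by have := inning_legal (p a); rewrite ps.
  move=> _; apply: (win (fun a => False_rect _ (K0 a))) => [a|]; first by case: (K0 a).
  by move=> O [x]; case: X0.
have legT : @legal _ _ P x0 setT by split=> //; exact: openT.
have move a (i : inning S) (h : history P a) :
    {j : inning P | snd_move j = sval (s a h (fst_move j)) /\
      (fst_move i = answers a h -> snd_move j = snd_move i)}.
  apply: cid; case: (pselect (fst_move i = answers a h)) => iC.
    (* A member of the prescribed cover is the answer of [s] to some [x], which becomes the
       translated move. *)
    have := inning_legal i; rewrite iC => -[x _ sx].
    by exists (Inning (svalP (s a h x))).
  by exists (Inning (svalP (s a h x0))).
have [T TP] := history_translation (fun a i h => sval (move a i h)) wf.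
exists (fun a h => answers a (T a h)) => p ps.
have [q qP] := TP p.
have qs a : snd_move (q a) = sval (s a (past q a) (fst_move (q a))).
  by case: (qP a) => -> _; case: (svalP (move a (p a) (past q a))).
have qp a : snd_move (q a) = snd_move (p a).
  case: (qP a) => qaE Tq; rewrite qaE.
  by case: (svalP (move a (p a) (past q a))) => _; apply; rewrite ps Tq.
by have := win q qs; rewrite /= (funext qp).
Qed.

Lemma selection_one_picking_two :
  one_has_winning_strategy S -> two_has_winning_strategy P.
Proof.
case=> s win.
have move a (i : inning P) (h : history S a) :
    {j : inning S | fst_move j = s a h /\
      (sval (s a h) (snd_move i) -> snd_move j = snd_move i)}.
  apply: cid; case: (pselect (sval (s a h) (snd_move i))) => CU.
    by exists (@Inning _ _ S (s a h) (snd_move i) CU).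
  (* Dummy reply off the strategy: any member of the cover, which exists since the picked point is
     covered. *)
  have [V [CV _]] := cover_member (s a h) (fst_move i).
  by exists (@Inning _ _ S (s a h) V CV).
have [T TP] := history_translation (fun a i h => sval (move a i h)) wf.
have answer a (h : history P a) (x : X) :
    {U : set X | legal (x : move1 P) U /\ sval (s a (T a h)) U}.
  apply: cid; have [U [CU Ux]] := cover_member (s a (T a h)) x.
  by exists U; do !split=> //; apply: cover_open CU.
exists (fun a h x => exist _ _ (svalP (answer a h x)).1) => p ps.
have [q qP] := TP p.
have qs a : fst_move (q a) = s a (past q a).
  by case: (qP a) => -> _; case: (svalP (move a (p a) (past q a))).
have qp a : snd_move (q a) = snd_move (p a).
  case: (qP a) => qaE Tq; rewrite qaE.
  case: (svalP (move a (p a) (past q a))) => _; apply.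
  by rewrite ps /= -Tq; case: (svalP (answer a (past p a) (fst_move (p a)))).
by have := win q qs; rewrite /= (funext qp).
Qed.

End Translations.

Theorem theorem3p8 (X : topologicalType) (d : Order.disp_t) (K : orderType d)
    (hK : is_cardinal K) :
  (one_has_winning_strategy (open_picking_game K X) <->
   two_has_winning_strategy (selection_game K X)) /\
  (two_has_winning_strategy (open_picking_game K X) <->
   one_has_winning_strategy (selection_game K X)).
Proof.
have wf := well_order_wf hK.1.
split; split.
- exact: picking_one_selection_two.
- exact: selection_two_picking_one.
- exact: picking_two_selection_one.
- exact: selection_one_picking_two.
Qed.
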